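(* Let $b \geq 1$ and $n\ge 3$ with $n\neq 6$. Let $D$ and $L$ be the distance matrix and the Laplacian matrix of $T_6 \circledcirc T_n^{(b)}$ (vertices ordered as described in the context). Then $D$ is invertible and $$D^{-1} = -\dfrac{1}{2}L +\dfrac{1}{2(b+1)}J + \dfrac{1}{2(b+1)(n-6)} R,$$ where $J$ is the all-ones matrix of the same order as $D$ and $R$ is the matrix defined in the context.
   Context: For $n\ge 3$, $T_n$ is the complete tripartite graph $K_{1,1,n-2}$, i.e. $n-2$ triangles sharing a common base edge; the two vertices in the parts of size $1$ are its base vertices, the remaining $n-2$ are non-base vertices. $T_6\circledcirc T_n^{(b)}$ is the graph obtained from one copy of $T_6$ and $b$ copies of $T_n$ by choosing one non-base vertex in each copy and identifying all chosen vertices to a single (central) vertex. The distance matrix has entries the graph distances; the Laplacian matrix has vertex degrees on the diagonal, $-1$ in entries $(u,v)$ with $u,v$ adjacent, and $0$ elsewhere. Vertex ordering: first the $5$ non-central vertices of $T_6$ (its $2$ base vertices, then its $3$ non-central non-base vertices); then, for each of the $b$ copies of $T_n$ in turn, its $n-1$ non-central vertices ($2$ base vertices, then $n-3$ non-central non-base vertices); finally the central vertex. When $n=3$, sub-blocks with a dimension $n-3=0$ are absent. $I_k$ is the identity, $J_{p\times q}$ the $p\times q$ all-ones matrix, $J_k=J_{k\times k}$, $\mathds 1_k$ the all-ones column vector of length $k$. With respect to this ordering, $R$ is the symmetric $(b+2)\times(b+2)$ block matrix (block sizes $5$, then $n-1$ repeated $b$ times, then $1$) whose block rows are: first block row $(R_1,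 R_2,\dots,R_2,\mathbf r_1)$; for $2\le i\le b+1$, block row $i$ has first block $R_2^t$, diagonal block $R_3$, blocks $R_4$ in the other positions $2,\dots,b+1$, and last block $\mathbf r_2$; last block row $(\mathbf r_1^t,\mathbf r_2^t,\dots,\mathbf r_2^t,r_3)$. Here $$R_1 = \begin{bmatrix} \left(4b(b+1) - (3b+4)(n-6)\right) J_2 + 4(n-6)(b+1)I_2 & -\left(2b(b+1)+(n-6) \right) J_{2 \times 3}\\ -\left(2b(b+1)+(n-6) \right)J_{3 \times 2} & \left(b(b+1)-(n-6) \right)J_3+(b+1)(n-6)I_3 \end{bmatrix},$$ $$R_2 = \begin{bmatrix} -\left(2(b+1)(n-4) +(n-6)\right) J_2 & \left(2(b+1)-(n-6) \right) J_{2 \times (n-3)}\\ \left((b+1)(n-4)-(n-6) \right)J_{3 \times 2} & -\left((b+1)+(n-6) \right)J_{3 \times (n-3)} \end{bmatrix},$$ $$R_3 = (b+1)\begin{bmatrix} \left(n-2 -\frac{n-6}{b+1} \right) J_2 + (n-2)(n-6)I_2 & -\left(n-4+\frac{n-6}{b+1} \right) J_{2 \times (n-3)}\\ -\left(n-4+\frac{n-6}{b+1} \right)J_{(n-3) \times 2} & \left(1 -\frac{n-6}{b+1} \right)J_{n-3}+(n-6)I_{n-3} \end{bmatrix},$$ $$R_4 = -(n-6)J_{n-1},\quad \mathbf r_1 = (n-6)\begin{bmatrix}\left(2b(b+1)-1 \right) \mathds{1}_2\\ -\left(b(b+1)+1 \right) \mathds{1}_3\end{bmatrix},\quad \mathbf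 r_2 = -(n-6)\mathds{1}_{n-1},\quad r_3=-b^2(n-6).$$ *)

(* Defs.v *)
From HB Require Import structures.
From mathcomp Require Import all_boot all_order all_algebra.

Set Implicit Arguments.
Unset Strict Implicit.
Unset Printing Implicit Defensive.

Import Order.TTheory GRing.Theory Num.Theory.
Local Open Scope ring_scope.

Section Graphs.
Variable T : finType.
Implicit Types (e : rel T) (x y : T).

Definition is_walk e (k : nat) x y : bool :=
  [exists p : k.-tuple T, path e x p && (last x p == y)].

(* The least length of a walk from x to y. In a connected graph it is < #|T|,
   so it is reached by the search; the value is #|T| when y is not reachable. *)
Definition gdist e x y : nat :=
  find (fun k => is_walk e k x y) (iota 0 #|T|).

Definition gdeg e x : nat := #|[set y | e x y]|.

End Graphs.

Definition dist_mx (F : nzRingType) N (e : rel 'I_N) : 'M[F]_N :=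
  \matrix_(u, v) (gdist e u v)%:R.

Definition laplacian_mx (F : nzRingType) N (e : rel 'I_N) : 'M[F]_N :=
  \matrix_(u, v)
    if u == v then (gdeg e u)%:R else if e u v then -1 else 0.

(* T_n = K_{1,1,n-2}: the parts are {0}, {1} and {2, ..., n-1}; the base
   vertices are 0 and 1. *)
Definition T_part n (i : 'I_n) : nat := minn i 2.
Definition T_adj n : rel 'I_n := fun i j => T_part i != T_part j.

(* The disjoint union of one copy of T_6 and b copies of T_n. *)
Definition pre_vertex (b n : nat) : finType := ('I_6 + 'I_b * 'I_n)%type.

Definition pre_adj b n : rel (pre_vertex b n) := fun p q =>
  match p, q with
  | inl x, inl y => T_adj x y
  | inr (k, x), inr (l, y) => (k == l) && T_adj x y
  | _, _ => false
  end.

(* The identification map, returning the position of the image of a vertex in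
   the vertex ordering. The last vertex of each copy (5 in T_6, n-1 in T_n, a
   non-base vertex when n >= 3) is the chosen one: all of them are sent to the
   central vertex, which comes last. *)
Definition glue b n (p : pre_vertex b n) : nat :=
  match p with
  | inl x => if (x < 5)%N then nat_of_ord x else (5 + b * n.-1)%N
  | inr (k, x) => if (x < n.-1)%N then (5 + k * n.-1 + x)%N
                  else (5 + b * n.-1)%N
  end.

(* The number of vertices, grouped as in the block decomposition of R.
   For n >= 3, the number 2 + (n - 3) is n - 1. *)
Notation coal_order b n :=
  ((2 + 3) + \sum_(i < b) (2 + (n - 3)) + 1)%N (only parsing).

Definition coal_adj b n : rel 'I_(coal_order b n) := fun u v =>
  [exists p : pre_vertex b n, exists q : pre_vertex b n,
    [&& glue p == u, glue q == v & pre_adj p q]].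

Section RMatrix.
Variables (F : fieldType) (b n : nat).

Let B : F := b%:R.
Let N : F := n%:R.

Local Notation J := (const_mx 1).
Local Notation I := (1%:M).

Definition R1 : 'M[F]_(2 + 3) :=
  block_mx
    ((4 * B * (B + 1) - (3 * B + 4) * (N - 6)) *: J
       + (4 * (N - 6) * (B + 1)) *: I)
    (- (2 * B * (B + 1) + (N - 6)) *: J)
    (- (2 * B * (B + 1) + (N - 6)) *: J)
    ((B * (B + 1) - (N - 6)) *: J + ((B + 1) * (N - 6)) *: I).

Definition R2 : 'M[F]_(2 + 3, 2 + (n - 3)) :=
  block_mx
    (- (2 * (B + 1) * (N - 4) + (N - 6)) *: J)
    ((2 * (B + 1) - (N - 6)) *: J)
    (((B + 1) * (N - 4) - (N - 6)) *: J)
    (- ((B + 1) + (N - 6)) *: J).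

Definition R3 : 'M[F]_(2 + (n - 3)) :=
  (B + 1) *:
  block_mx
    ((N - 2 - (N - 6) / (B + 1)) *: J + ((N - 2) * (N - 6)) *: I)
    (- (N - 4 + (N - 6) / (B + 1)) *: J)
    (- (N - 4 + (N - 6) / (B + 1)) *: J)
    ((1 - (N - 6) / (B + 1)) *: J + (N - 6) *: I).

Definition R4 : 'M[F]_(2 + (n - 3)) := - (N - 6) *: J.

Definition r1 : 'cV[F]_(2 + 3) :=
  (N - 6) *: col_mx ((2 * B * (B + 1) - 1) *: J)
                    (- (B * (B + 1) + 1) *: J).

Definition r2 : 'cV[F]_(2 + (n - 3)) := - (N - 6) *: J.

Definition r3 : F := - B ^+ 2 * (N - 6).

Definition R_mx : 'M[F]_(coal_order b n) :=
  block_mx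
    (block_mx
       R1                     (\mxrow_(j < b) R2)
       (\mxcol_(i < b) R2^T)  (\mxblock_(i < b, j < b) (if i == j then R3 else R4)))
    (col_mx r1 (\mxcol_(i < b) r2))
    (row_mx r1^T (\mxrow_(j < b) r2^T))
    r3%:M.

End RMatrix.

(* Main.v *)
Require Import Defs.
From HB Require Import structures.
From mathcomp Require Import all_boot all_order all_algebra.
From mathcomp Require Import zify ring.

Set Implicit Arguments.
Unset Strict Implicit.
Unset Printing Implicit Defensive.

Import Order.TTheory GRing.Theory Num.Theory.
Local Open Scope ring_scope.

(** Write delta(u) for the distance from u to the central vertex, and call arms
the copies of T_6 and T_n with the central vertex removed. Two vertices in
different arms are at distance delta(u) + delta(v), so the distance matrix is

  D = delta 1^t + 1 delta^t - G,

where G is block diagonal over the arms (it is twice the Gromov product based at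
the central vertex) and vanishes on the central vertex. Hence D x is known as
soon as one knows the sum 1^t x, the moment delta^t x and, in each arm, the sums
of x over the base vertices and over the other vertices.

Put p = n - 6. The right-hand side of the theorem, multiplied by 2 p, has the
simple entries scaled_inv: modulo b + 1 the matrix R is - p J, so that no
denominator b + 1 remains. It is left to see that D times scaled_inv is 2 p I,
which by the formula for D comes down to three facts about the columns of
scaled_inv.

 - Let z be 2 on the base vertices of T_6, -1 on its three other non-central
   vertices and 0 elsewhere. Then G z = 0, 1^t z = 1 and delta^t z = -2, so that
   D z = delta - 2 1; as delta = D e_c is the column of the central vertex c,
   D (e_c - z) = 2 1. So the columns of 2 p D^-1 have to sum to p (e_c - z)^t
   (scaled_inv_sum).
 - As delta^t is a row of D, the moments of those columns have to be 2 p e_c^t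
   (scaled_inv_moment).
 - The product of G with scaled_inv has to be p delta (e_c - z)^t
   + 2 p 1 e_c^t - 2 p I (gromov_scaled_inv).

The condition n <> 6 is needed for invertibility: the analogue y of z in an arm
T_n, equal to n - 4 on base vertices and -1 elsewhere, has G y = p delta on its
arm, and for p = 0 the vector z - y would be in the kernel of D.

The graph enters through its distances, adjacencies and degrees. These are
computed on a concrete type of vertices, in bijection with the positions of the
vertex ordering; the distances come from a potential argument. *)

(** * Distances from potentials *)

(** The Lipschitz condition makes phi a lower bound for the length of walks from
x, and descending along neighbours of smaller potential produces a walk of that
length. *)
Lemma gdist_potential (T : finType) (e : rel T) (phi : T -> nat) x y :
    phi x = 0%N -> (forall u v, e u v -> phi v <= (phi u).+1)%N ->
    (forall v, v != x -> exists2 z, e z v & phi v = (phi z).+1) ->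
    (phi y < #|T|)%N ->
  gdist e x y = phi y.
Proof.
move=> phix lip pred_ phiy.
have walk_lb p z : path e z p -> (phi (last z p) <= phi z + size p)%N.
  elim: p z => [|w p IHp] z /=; first by rewrite addn0.
  case/andP=> zw /IHp le_w; apply: leq_trans le_w _.
  by rewrite addnS -addSn leq_add2r lip.
have walk_ub k : forall z, phi z = k -> is_walk e k x z.
  elim: k => [|k IHk] z phiz.
    apply/existsP; exists [tuple]; rewrite /=.
    by case: (eqVneq z x) => [//|/pred_[w _]]; rewrite phiz.
  have [|w wz] := pred_ z; first by apply: contra_eq_neq phiz => ->; rewrite phix.
  rewrite phiz => -[/esym/IHk/existsP[p /andP[ep /eqP lp]]].
  apply/existsP; exists [tuple of rcons p z].
  by rewrite /= rcons_path ep lp wz last_rcons eqxx.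
rewrite /gdist; apply/eqP; rewrite eqn_leq; apply/andP; split.
  rewrite leqNgt; apply/negP => /(before_find 0%N).
  by rewrite nth_iota // add0n walk_ub.
have [le_phi|] := leqP (phi y) (find (fun k => is_walk e k x y) (iota 0 #|T|)) => //.
move=> lt_phi; have lt_find := ltn_trans lt_phi phiy.
have := lt_find; rewrite -{2}(size_iota 0 #|T|) -has_find => /(nth_find 0%N).
rewrite nth_iota // add0n => /existsP[p /andP[/walk_lb lb /eqP lp]].
by move: lb; rewrite lp phix size_tuple add0n leqNgt lt_phi.
Qed.

(** * A concrete type of vertices *)

Section Vertices.
Variables b n : nat.

(** The non-central vertices; the left summand is the arm T_6, and in each arm the
base vertices come first. The central vertex is the None of vtx. *)
Definition rim : finType := (('I_2 + 'I_3) + 'I_b * ('I_2 + 'I_(n - 3)))%type.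
Definition vtx : finType := option rim.

Definition TB (i : 'I_2) : rim := inl (inl i).
Definition TN (j : 'I_3) : rim := inl (inr j).
Definition CB (k : 'I_b) (i : 'I_2) : rim := inr (k, inl i).
Definition CN (k : 'I_b) (j : 'I_(n - 3)) : rim := inr (k, inr j).

Definition arm (a : rim) : option 'I_b := if a is inr (k, _) then Some k else None.

Definition is_base (a : rim) : bool :=
  match a with inl (inl _) | inr (_, inl _) => true | _ => false end.

Definition vadj : rel vtx := fun u v =>
  match u, v with
  | Some a, Some c => [&& arm a == arm c, a != c & is_base a || is_base c]
  | Some a, None | None, Some a => is_base a
  | None, None => false
  end.

(** The distance to the central vertex. *)
Definition depth (u : vtx) : nat := if u is Some a then (~~ is_base a).+1 else 0.

Definition vdist (u v : vtx) : nat :=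
  match u, v with
  | Some a, Some c =>
      if arm a == arm c then
        if a == c then 0 else if is_base a || is_base c then 1 else 2
      else depth u + depth v
  | _, _ => depth u + depth v
  end.

Lemma vdist_lipschitz (u v w : vtx) : vadj v w -> (vdist u w <= (vdist u v).+1)%N.
Proof.
case: u v w => [a|] [c|] [d|] //=.
- case/and3P=> /eqP eq_cd _ cd; rewrite -eq_cd; case: ifP => _; last by lia.
  case: (eqVneq a c) => [->|_]; first by case: ifP => // _; rewrite cd.
  by case: (a == d); case: (is_base a); case: (is_base c); case: (is_base d).
- move=> base_c; case: (eqVneq a c) => [->|_]; first by rewrite base_c eqxx.
  by case: ifP => _; case: (is_base a); case: (is_base c).
- by case: ifP => _; case: (a == d); case: (is_base a); case: (is_base d).
- by lia.
- by lia.
Qed.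

Lemma vdist_pred (u v : vtx) :
  v != u -> exists2 z, vadj z v & vdist u v = (vdist u z).+1.
Proof.
(* a base vertex of the arm of a, through which shortest paths to a can go *)
pose hub (a : rim) : rim := if a is inr (k, _) then CB k ord0 else TB ord0.
have arm_hub a : arm (hub a) = arm a by case: a => [|[]].
have base_hub a : is_base (hub a) by case: a => [|[]].
have hub_ne a : ~~ is_base a -> hub a != a.
  by apply: contraNneq => <-; apply: base_hub.
case: u v => [a|] [c|] //= ne_ca.
- case: (eqVneq (arm a) (arm c)) => [eq_ac|ne_ac].
    have ne_ac : a == c = false.
      by rewrite eq_sym; apply/negP => /eqP eq_ca; rewrite eq_ca eqxx in ne_ca.
    rewrite ne_ac; case: ifPn => [ac|].
      by exists (Some a); rewrite /= ?eqxx // eq_ac eqxx ne_ac.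
    rewrite negb_or => /andP[nba nbc].
    exists (Some (hub a)); rewrite /= arm_hub ?eqxx.
      by rewrite eq_ac eqxx base_hub /= andbT; apply: contra nbc => /eqP <-.
    by rewrite eq_sym (negPf (hub_ne _ nba)) base_hub orbT.
  case: (boolP (is_base c)) => [bc|nbc].
    by exists None => //=; lia.
  exists (Some (hub c)); rewrite /= arm_hub ?eqxx ?base_hub ?hub_ne //.
  by rewrite (negPf ne_ac) /=; lia.
- case: (boolP (is_base a)) => [ba|nba].
    by exists (Some a); rewrite //= !eqxx.
  exists (Some (hub a)); rewrite /= ?base_hub //.
  by rewrite arm_hub eqxx eq_sym (negPf (hub_ne _ nba)).
- case: (boolP (is_base c)) => [bc|nbc]; first by exists None.
  by exists (Some (hub c)); rewrite /= ?base_hub // arm_hub eqxx hub_ne.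
Qed.

(** The position of a vertex in the block decomposition of the matrices: the
sum over copies is entered through Rank, the enumeration used by mxblock. *)
Definition pos (u : vtx) : 'I_(coal_order b n) :=
  match u with
  | Some (inl r) => lshift 1 (lshift _ (unsplit r))
  | Some (inr (k, r)) =>
      lshift 1 (rshift (2 + 3)
        (tagnat.Rank (p_ := fun=> (2 + (n - 3))%N) k (unsplit r)))
  | None => rshift _ ord0
  end.

Lemma pos_inj : injective pos.
Proof.
have us_inj m1 m2 : injective (@unsplit m1 m2) by apply: can_inj (@unsplitK m1 m2).
move=> [[r|[k r]]|] [[s|[l s]]|] //= /eqP;
  rewrite ?eq_lshift ?eq_rshift ?eq_lrshift ?eq_rlshift //.
  by move=> /eqP/us_inj ->.
rewrite -val_eqE tagnat.eq_Rank => /andP[/eqP -> ].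
by rewrite val_eqE => /eqP/us_inj ->.
Qed.

Lemma pos_bij : bijective pos.
Proof.
apply: (inj_card_bij pos_inj).
rewrite card_ord /vtx card_option !(card_sum, card_prod, card_ord) sum_nat_const card_ord.
by rewrite addn1.
Qed.

Lemma sum_vtx (V : nmodType) (f : vtx -> V) :
  \sum_u f u =
  f None + (\sum_i f (Some (TB i)) + \sum_j f (Some (TN j))
   + \sum_k (\sum_i f (Some (CB k i)) + \sum_j f (Some (CN k j)))).
Proof.
rewrite (bigD1 None) //=; congr (_ + _).
rewrite (reindex_omap Some id) /=; last by case.
under eq_bigl do rewrite eqxx.
rewrite big_sumType big_sumType /=; congr (_ + _).
rewrite (eq_bigr (fun i => f (Some (inr (i.1, i.2))))); last by case.
rewrite -(pair_bigA _ (fun k r => f (Some (inr (k, r))))) /=.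
by apply: eq_bigr => k _; rewrite big_sumType.
Qed.

End Vertices.
Arguments TB {b n}.
Arguments TN {b n}.
Arguments CB {b n}.
Arguments CN {b n}.

(** * The glued graph *)

Section Gluing.
Variables b n : nat.
Hypothesis hn : (3 <= n)%N.

(** The vertex of an arm at rank x in K_{1,1,m+1}, or None for the last rank, which
is the vertex identified with the central one. *)
Definition role m (x : nat) : option ('I_2 + 'I_m) :=
  if (x < 2)%N then Some (inl (inord x)) else omap inr (insub (x - 2)%N).

Variant role_spec m (x : nat) : option ('I_2 + 'I_m) -> Prop :=
  | RoleBase (i : 'I_2) of x = i : role_spec x (Some (inl i))
  | RoleTip (j : 'I_m) of x = (2 + j)%N : role_spec x (Some (inr j))
  | RoleChosen of x = (2 + m)%N : role_spec x None.

Lemma roleP m x : (x < m + 3)%N -> role_spec x (role m x).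
Proof.
move=> lt_x; rewrite /role; case: ltnP => [lt2|ge2].
  by apply: RoleBase; rewrite inordK.
case: insubP => [j ltj valj|] /=; first by apply: RoleTip; rewrite valj subnKC.
by rewrite -leqNgt => le_m; apply: RoleChosen; lia.
Qed.

Lemma role_unsplit m (r : 'I_2 + 'I_m) : role m (unsplit r) = Some r.
Proof.
case: r => r; rewrite /role /=; first by rewrite ltn_ord inord_val.
by rewrite addKn valK.
Qed.

Lemma role_chosen m : role m (2 + m) = None.
Proof. by rewrite /role ltnNge leq_addr addKn insubF ?ltnn. Qed.

(** The quotient map of the identification. *)
Definition merge (p : pre_vertex b n) : vtx b n :=
  match p with
  | inl x => omap inl (role 3 x)
  | inr (k, x) => omap (fun r => inr (k, r)) (role (n - 3) x)
  end.

Lemma glue_pos p : glue p = pos (merge p) :> nat.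
Proof.
have sum_c k : (k <= b)%N -> (\sum_(l < b | l < k) (2 + (n - 3)) = k * n.-1)%N.
  move=> le_k; rewrite -(big_ord_widen _ (fun=> (2 + (n - 3))%N)) // sum_nat_const.
  by rewrite card_ord; congr (_ * _)%N; lia.
have sum_all : (\sum_(l < b) (2 + (n - 3)) = b * n.-1)%N.
  by rewrite -(sum_c b) //; apply: eq_bigl => l; rewrite ltn_ord.
have pos_copy (k : 'I_b) (r : 'I_2 + 'I_(n - 3)) :
    pos (Some (inr (k, r))) = (5 + (k * n.-1 + unsplit r))%N :> nat.
  rewrite -(sum_c k (ltnW (ltn_ord k))).
  exact: (congr1 (addn 5)
    (@tagnat.RankEsum b (fun=> (2 + (n - 3))%N) k (unsplit r))).
case: p => [x|[k x]].
  rewrite /=; case: (@roleP 3 x) => [|i|j|] //= ->; rewrite ?sum_all.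
  - by rewrite (ltn_trans (ltn_ord i)).
  - by rewrite (_ : (2 + j < 5)%N) //; have := ltn_ord j; lia.
  - by rewrite addn0.
have lt_x : (x < n - 3 + 3)%N by rewrite subnK.
have def_n1 : n.-1 = (2 + (n - 3))%N by lia.
rewrite /glue /merge.
case: (roleP lt_x) => [i|j|] ->; rewrite [omap _ _]/= ?pos_copy.
- by rewrite def_n1 (leq_trans (ltn_ord i)) ?leq_addr // addnA.
- by rewrite def_n1 ltn_add2l ltn_ord -addnA.
- by rewrite def_n1 ltnn /= addn0 sum_all def_n1.
Qed.

Definition role_adj m (r s : option ('I_2 + 'I_m)) : bool :=
  match r, s with
  | Some (inl i), Some (inl j) => i != j
  | Some (inl _), _ | _, Some (inl _) => true
  | _, _ => false
  end.

Lemma T_adj_role m N (x y : 'I_N) : N = (m + 3)%N ->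
  T_adj x y = role_adj (role m x) (role m y).
Proof.
move=> defN.
have lt_m (z : 'I_N) : (z < m + 3)%N by rewrite -defN.
rewrite /T_adj /T_part.
case: (roleP (lt_m x)) => [i|j|] ->; case: (roleP (lt_m y)) => [i'|j'|] -> /=.
all: rewrite -?val_eqE /=; try (have := ltn_ord i); try (have := ltn_ord i'); lia.
Qed.

Lemma pre_adj_vadj p q : pre_adj p q -> vadj (merge p) (merge q).
Proof.
have def_n : n = (n - 3 + 3)%N by rewrite subnK.
case: p q => [x|[k x]] [y|[l y]] //=.
  rewrite (@T_adj_role 3) //.
  case: role => [[i|j]|]; case: role => [[i'|j']|] //= ne_i.
  by rewrite andbT; apply: contra ne_i => /eqP[->].
case/andP=> /eqP <-; rewrite (T_adj_role _ _ def_n).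
by case: role => [[i|j]|]; case: role => [[i'|j']|] //= ne_i;
   rewrite eqxx //= andbT; apply/eqP => -[] // eq_i; rewrite eq_i eqxx in ne_i.
Qed.

(** An edge of the glued graph lifts to one copy: a central endpoint is lifted to
the chosen vertex of the copy that contains the other endpoint. *)
Lemma vadj_pre_adj u v : vadj u v ->
  exists p q, [/\ merge p = u, merge q = v & pre_adj p q].
Proof.
have def_n : n = (n - 3 + 3)%N by rewrite subnK.
have def_n1 : (2 + (n - 3) < n)%N by lia.
pose inT (r : 'I_2 + 'I_3) : pre_vertex b n := inl (inord (unsplit r)).
pose cT : pre_vertex b n := inl (inord 5).
have valT (r : 'I_2 + 'I_3) : @inord 5 (unsplit r) = unsplit r :> nat.
  by rewrite inordK // ltnS ltnW // ltn_ord.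
have valc : @inord 5 5 = 5%N :> nat by rewrite inordK.
have lt_r (r : 'I_2 + 'I_(n - 3)) : (unsplit r < n)%N.
  by apply: leq_trans (ltn_ord _) _; lia.
pose inC k r : pre_vertex b n := inr (k, Ordinal (lt_r r)).
pose cC k : pre_vertex b n := inr (k, Ordinal def_n1).
have inTE r : merge (inT r) = Some (inl r).
  by rewrite /= valT role_unsplit.
have cTE : merge cT = None by rewrite /= valc role_chosen.
have inCE k r : merge (inC k r) = Some (inr (k, r)) by rewrite /= role_unsplit.
have cCE k : merge (cC k) = None by rewrite /= role_chosen.
case: u v => [[r|[k r]]|] [[s|[l s]]|] //= uv.
- exists (inT r), (inT s); rewrite !inTE; split=> //=.
  rewrite (@T_adj_role 3) // ?valT ?valc ?role_unsplit ?role_chosen.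
  by case: r s uv => [i|j] [i'|j'] //=; rewrite -?(inj_eq inl_inj); case/andP.
- exists (inT r), cT; rewrite inTE cTE; split=> //=.
  rewrite (@T_adj_role 3) // ?valT ?valc ?role_unsplit ?role_chosen.
  by case: r uv.
- case/and3P: uv => /eqP[<-] ne_rs base_rs.
  exists (inC k r), (inC k s); rewrite !inCE; split=> //=.
  rewrite eqxx (T_adj_role _ _ def_n) /= !role_unsplit.
  by case: r s ne_rs base_rs => [i|j] [i'|j'] //= + _; apply: contra => /eqP ->.
- exists (inC k r), (cC k); rewrite inCE cCE; split=> //=.
  by rewrite eqxx (T_adj_role _ _ def_n) /= role_unsplit role_chosen; case: r uv.
- exists cT, (inT s); rewrite inTE cTE; split=> //=.
  rewrite (@T_adj_role 3) // ?valT ?valc ?role_unsplit ?role_chosen.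
  by case: s uv.
- exists (cC l), (inC l s); rewrite inCE cCE; split=> //=.
  by rewrite eqxx (T_adj_role _ _ def_n) /= role_unsplit role_chosen; case: s uv.
Qed.

Lemma coal_adj_pos u v : @coal_adj b n (pos u) (pos v) = vadj u v.
Proof.
apply/existsP/idP => [[p /existsP[q /and3P[]]]|].
  rewrite !glue_pos => /eqP/val_inj/pos_inj <- /eqP/val_inj/pos_inj <-.
  exact: pre_adj_vadj.
case/vadj_pre_adj => p [q [<- <- pq]]; exists p; apply/existsP; exists q.
by rewrite !glue_pos !eqxx.
Qed.

Lemma gdist_pos u v : gdist (@coal_adj b n) (pos u) (pos v) = vdist u v.
Proof.
have [vof posK vofK] := pos_bij b n.
rewrite -[in RHS](posK v).
apply: (gdist_potential (phi := fun x => vdist u (vof x))) => [|x y|x|].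
- by rewrite posK; case: u => //= a; rewrite !eqxx.
- rewrite -{1}(vofK x) -{1}(vofK y) coal_adj_pos; exact: vdist_lipschitz.
- rewrite -{1 2}(vofK x) (inj_eq (@pos_inj b n)) => /vdist_pred[z zx ->].
  by exists (pos z); rewrite ?coal_adj_pos // posK.
- rewrite posK card_ord addn1 ltnS -addnA (@leq_trans 4) //.
  have d2 (w : vtx b n) : (depth w <= 2)%N by case: w => //= a; case: is_base.
  have := leq_add (d2 u) (d2 v); case: u v => [a|] [c|] //=.
  by case: ifP => _ //; case: ifP => // _; case: ifP.
Qed.

End Gluing.

(** * The distance matrix through the Gromov product *)

Lemma pair_eqE (S R : eqType) (x y : S) (z w : R) :
  ((x, z) == (y, w)) = (x == y) && (z == w).
Proof. by []. Qed.

Lemma some_eqE (S : eqType) (x y : S) : (Some x == Some y) = (x == y).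
Proof. by []. Qed.

Lemma inl_eqE (S R : eqType) (x y : S) : ((inl x : S + R) == inl y) = (x == y).
Proof. by []. Qed.

Lemma inr_eqE (S R : eqType) (x y : R) : ((inr x : S + R) == inr y) = (x == y).
Proof. by []. Qed.

Lemma inlr_eqE (S R : eqType) (x : S) (y : R) : ((inl x : S + R) == inr y) = false.
Proof. by []. Qed.

Lemma inrl_eqE (S R : eqType) (x : S) (y : R) : ((inr y : S + R) == inl x) = false.
Proof. by []. Qed.

Definition vtx_eqE := (some_eqE, pair_eqE, inl_eqE, inr_eqE, inlr_eqE, inrl_eqE).

Section Inverse.
Variables (F : realFieldType) (b n : nat).
Hypothesis hn : (3 <= n)%N.

Local Notation B := (b%:R : F).
Local Notation p := (n%:R - 6 : F).
Local Notation q := (n%:R - 4 : F).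
Local Notation vtx := (vtx b n).

(** Twice the Gromov product with respect to the central vertex. *)
Definition gromov (u w : vtx) : F :=
  match u, w with
  | Some (inl r), Some (inl s) =>
      match r, s with
      | inl i, inl j => 1 + (j == i)%:R * 1
      | inr i, inr j => 2 + (j == i)%:R * 2
      | _, _ => 2
      end
  | Some (inr (k, r)), Some (inr (l, s)) => (l == k)%:R *
      match r, s with
      | inl i, inl j => 1 + (j == i)%:R * 1
      | inr i, inr j => 2 + (j == i)%:R * 2
      | _, _ => 2
      end
  | _, _ => 0
  end.

Lemma vdist_gromov (u w : vtx) :
  (vdist u w)%:R = (depth u)%:R + (depth w)%:R - gromov u w.
Proof.
case: u w => [[[i|j]|[k [i|j]]]|] [[[i'|j']|[k' [i'|j']]]|] //=.
all: rewrite ?vtx_eqE //=.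
all: rewrite 1?[k' == k]eq_sym 1?[i' == i]eq_sym 1?[j' == j]eq_sym.
all: try case: (k == k').
all: try case: (i == i').
all: try case: (j == j').
all: rewrite /= ?addn0 ?natrD; ring.
Qed.

Lemma sum_pick (I : finType) (i : I) (f : I -> F) : \sum_j (j == i)%:R * f j = f i.
Proof.
rewrite (bigD1 i) //= eqxx mul1r big1 ?addr0 // => j /negPf ->.
by rewrite mul0r.
Qed.

Lemma sum_affine m (i : 'I_m) (c d : F) :
  \sum_(j < m) (c + (j == i)%:R * d) = m%:R * c + d.
Proof.
by rewrite big_split /= sum_pick sumr_const card_ord mulr_natl.
Qed.

Lemma sum_cst m (c : F) : \sum_(j < m) c = m%:R * c.
Proof. by rewrite sumr_const card_ord mulr_natl. Qed.

(** Within an arm the Gromov form depends on the kinds of the two vertices only,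
up to a diagonal term. *)
Lemma gromov_sum (u : vtx) (x : vtx -> F) :
  \sum_w gromov u w * x w =
  match u with
  | Some (inl r) =>
      (if r is inl _ then 1 else 2) * \sum_i x (Some (TB i)) + 2 * \sum_j x (Some (TN j))
      + (if r is inl _ then 1 else 2) * x u
  | Some (inr (k, r)) =>
      (if r is inl _ then 1 else 2) * \sum_i x (Some (CB k i)) + 2 * \sum_j x (Some (CN k j))
      + (if r is inl _ then 1 else 2) * x u
  | None => 0
  end.
Proof.
have sum_base m (i : 'I_m) (c : F) (f : 'I_m -> F) :
    \sum_j (c + (j == i)%:R * c) * f j = c * \sum_j f j + c * f i.
  under eq_bigr do rewrite mulrDl -mulrA.
  by rewrite big_split /= sum_pick -mulr_sumr.
have null (I : finType) (f : I -> F) : \sum_i 0 * f i = 0.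
  by rewrite -mulr_sumr mul0r.
rewrite sum_vtx; case: u => [[r|[k r]]|] /=.
- rewrite [X in _ + (_ + X)]big1; last by move=> k _; rewrite !null addr0.
  rewrite mul0r add0r addr0; case: r => [i|j] /=.
    by rewrite sum_base -mulr_sumr; ring.
  by rewrite sum_base -mulr_sumr; ring.
- rewrite !null mul0r !add0r.
  have pull (g : 'I_2 -> F) (h : 'I_(n - 3) -> F) :
      \sum_l (\sum_i (l == k)%:R * g i * x (Some (CB l i))
              + \sum_j (l == k)%:R * h j * x (Some (CN l j)))
      = \sum_i g i * x (Some (CB k i)) + \sum_j h j * x (Some (CN k j)).
    rewrite -[RHS](sum_pick k (fun l => \sum_i g i * x (Some (CB l i))
                                       + \sum_j h j * x (Some (CN l j)))).
    apply: eq_bigr => l _; rewrite mulrDr !mulr_sumr.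
    by congr (_ + _); apply: eq_bigr => ? _; rewrite mulrA.
  case: r => [i|j] /=.
    rewrite [LHS](pull (fun j => 1 + (j == i)%:R * 1) (fun=> 2)).
    by rewrite sum_base -mulr_sumr; ring.
  rewrite [LHS](pull (fun=> 2) (fun i => 2 + (i == j)%:R * 2)).
  by rewrite sum_base -mulr_sumr; ring.
- by rewrite !null big1 ?mul0r ?addr0 // => k _; rewrite !null addr0.
Qed.

(** * The inverse matrix *)

Definition scaled_inv_center (a : rim b n) : F :=
  match a with
  | inl (inl _) => p * (1 + 2 * B)
  | inl (inr _) => - (B * p)
  | inr (_, inl _) => p
  | inr (_, inr _) => 0
  end.

(** Written so that every sum over a block of rows is an instance of sum_affine. *)
Definition scaled_inv_rim (a c : rim b n) : F :=
  match a, c with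
  | inl (inl i), inl (inl j) => 4 * B - 2 * p + (i == j)%:R * (- 2 * p)
  | inl (inl _), inl (inr _) | inl (inr _), inl (inl _) => p - 2 * B
  | inl (inr i), inl (inr j) => B + (i == j)%:R * - p
  | inl (inl _), inr (_, inl _) | inr (_, inl _), inl (inl _) => - 2 * q
  | inl (inl _), inr (_, inr _) | inr (_, inr _), inl (inl _) => 2
  | inl (inr _), inr (_, inl _) | inr (_, inl _), inl (inr _) => q
  | inl (inr _), inr (_, inr _) | inr (_, inr _), inl (inr _) => - 1
  | inr (k, inl i), inr (l, inl j) => (k == l)%:R * (2 * q + (i == j)%:R * (- 2 * p))
  | inr (k, inr i), inr (l, inr j) => (k == l)%:R * (1 + (i == j)%:R * - p)
  | inr (k, _), inr (l, _) => (k == l)%:R * - 2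
  end.

(** The inverse of the distance matrix, multiplied by 2 (n - 6). *)
Definition scaled_inv (u v : vtx) : F :=
  match u, v with
  | Some a, Some c => scaled_inv_rim a c
  | Some a, None | None, Some a => scaled_inv_center a
  | None, None => - (3 * B + 1) * p
  end.

(** Spans the kernel of the Gromov form on the arm T_6. *)
Definition T6_kernel (v : vtx) : F :=
  match v with
  | Some (inl (inl _)) => 2
  | Some (inl (inr _)) => - 1
  | _ => 0
  end.

Let natn3 : (n - 3)%:R = n%:R - 3 :> F.
Proof. by rewrite natrB. Qed.

(** The sums are those of 2 p D^-1 because D (e_c - z) = 2 1, where z is T6_kernel. *)
Lemma scaled_inv_sum v : \sum_w scaled_inv w v = p * ((v == None)%:R - T6_kernel v).
Proof.
rewrite sum_vtx; case: v => [[[i|j]|[l [i|j]]]|] /=; rewrite ?sum_affine ?sum_cst.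
- by rewrite natn3; ring.
- by rewrite natn3; ring.
- under [X in _ + (_ + X)]eq_bigr do rewrite -!mulr_sumr sum_affine sum_cst -mulrDr.
  by rewrite sum_pick natn3; ring.
- under [X in _ + (_ + X)]eq_bigr do rewrite -!mulr_sumr sum_affine sum_cst -mulrDr.
  by rewrite sum_pick natn3; ring.
- by rewrite natn3; ring.
Qed.

(** The depths form the row of the central vertex in D. *)
Lemma scaled_inv_moment v : \sum_w (depth w)%:R * scaled_inv w v = 2 * p * (v == None)%:R.
Proof.
rewrite sum_vtx /=; under [X in _ + (_ + X)]eq_bigr do rewrite -!mulr_sumr.
rewrite -!mulr_sumr; case: v => [[[i|j]|[l [i|j]]]|] /=; rewrite ?sum_affine ?sum_cst.
- by rewrite natn3; ring.
- by rewrite natn3; ring.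
- under [X in _ + (_ + X)]eq_bigr do
    rewrite -!mulr_sumr sum_affine sum_cst ![_ * ((_ == _)%:R * _)]mulrCA -mulrDr.
  by rewrite sum_pick natn3; ring.
- under [X in _ + (_ + X)]eq_bigr do
    rewrite -!mulr_sumr sum_affine sum_cst ![_ * ((_ == _)%:R * _)]mulrCA -mulrDr.
  by rewrite sum_pick natn3; ring.
- by rewrite natn3; ring.
Qed.

(** Equivalent to vdist_scaled_inv, given the sums and moments of the columns. *)
Lemma gromov_scaled_inv u v :
  \sum_w gromov u w * scaled_inv w v =
  (depth u)%:R * (p * ((v == None)%:R - T6_kernel v)) + 2 * p * (v == None)%:R
  - 2 * p * (u == v)%:R.
Proof.
rewrite gromov_sum.
case: u v => [[[i|j]|[k [i|j]]]|] [[[i'|j']|[k' [i'|j']]]|] /=.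
all: rewrite ?vtx_eqE ?andbF /=.
all: rewrite -?mulr_sumr ?sum_affine ?sum_cst ?natn3 -?mulnb ?natrM.
all: ring.
Qed.

Lemma vdist_scaled_inv u v : \sum_w (vdist u w)%:R * scaled_inv w v = 2 * p * (u == v)%:R.
Proof.
under eq_bigr do rewrite vdist_gromov mulrBl mulrDl.
rewrite sumrB big_split /= -mulr_sumr scaled_inv_sum scaled_inv_moment.
by rewrite gromov_scaled_inv; ring.
Qed.

(** * Entries of the closed formula *)

(** Shaped for sum_affine, as scaled_inv_rim is. *)
Definition adj_coef (w u : vtx) : F :=
  match w, u with
  | Some (inl (inl i)), Some (inl (inl j)) => 1 + (i == j)%:R * - 1
  | Some (inl (inr _)), Some (inl (inr _)) => 0
  | Some (inl _), Some (inl _) => 1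
  | Some (inr (k, inl i)), Some (inr (l, inl j)) => (k == l)%:R * (1 + (i == j)%:R * - 1)
  | Some (inr (k, inr _)), Some (inr (l, inr _)) => (k == l)%:R * 0
  | Some (inr (k, _)), Some (inr (l, _)) => (k == l)%:R * 1
  | Some a, None | None, Some a => (is_base a)%:R
  | _, _ => 0
  end.

Lemma vadj_coef w u : (vadj w u)%:R = adj_coef w u.
Proof.
case: w u => [[[i|j]|[k [i|j]]]|] [[[i'|j']|[k' [i'|j']]]|] //=.
all: rewrite ?vtx_eqE ?andbT ?andbF ?mulr0 -?mulnb ?natrM //=.
all: try case: (k == k').
all: case: (i == i') => /=.
all: ring.
Qed.

Lemma gdeg_coef u : (gdeg (@coal_adj b n) (pos u))%:R =
  match u with
  | Some (inl (inl _)) => 5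
  | Some (inr (_, inl _)) => n%:R - 1
  | Some _ => 2
  | None => 2 * (B + 1)
  end.
Proof.
have vadjC v w : vadj v w = vadj w v :> bool.
  by case: v w => [a|] [c|] //=; rewrite orbC [arm a == _]eq_sym [a == _]eq_sym.
have -> : (gdeg (@coal_adj b n) (pos u))%:R = \sum_w adj_coef w u.
  rewrite /gdeg -sum1_card natr_sum big_mkcond.
  rewrite (reindex _ (onW_bij _ (pos_bij b n))) /=; apply: eq_bigr => w _.
  by rewrite -vadj_coef inE coal_adj_pos // vadjC; case: vadj.
rewrite sum_vtx; case: u => [[[i|j]|[l [i|j]]]|] /=; rewrite ?sum_affine ?sum_cst.
- by rewrite natn3; ring.
- by rewrite natn3; ring.
- under [X in _ + (_ + X)]eq_bigr do rewrite -!mulr_sumr sum_affine sum_cst -mulrDr.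
  by rewrite sum_pick natn3; ring.
- under [X in _ + (_ + X)]eq_bigr do rewrite -!mulr_sumr !sum_cst -mulrDr.
  by rewrite sum_pick natn3; ring.
- by rewrite natn3; ring.
Qed.

Lemma mxblock_const m1 m2 (M : 'I_b -> 'I_b -> 'M[F]_(m1, m2)) k l x y :
  (\mxblock_(i < b, j < b) M i j) (tagnat.Rank (p_ := fun=> m1) k x)
    (tagnat.Rank (p_ := fun=> m2) l y) = M k l x y.
Proof. by have := mxblockK M k l => /matrixP/(_ x y) <-; rewrite [RHS]mxE. Qed.

Lemma mxrow_const m m2 (M : 'I_b -> 'M[F]_(m, m2)) l x y :
  (\mxrow_(j < b) M j) x (tagnat.Rank (p_ := fun=> m2) l y) = M l x y.
Proof. by have := mxrowK M l => /matrixP/(_ x y) <-; rewrite [RHS]mxE. Qed.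

Lemma mxcol_const m m1 (M : 'I_b -> 'M[F]_(m1, m)) k x y :
  (\mxcol_(i < b) M i) (tagnat.Rank (p_ := fun=> m1) k x) y = M k x y.
Proof. by have := mxcolK M k => /matrixP/(_ x y) <-; rewrite [RHS]mxE. Qed.

(** Modulo b + 1 every entry of R is - (n - 6), which cancels the contribution of
J: over the common denominator 2 (b + 1) (n - 6), the numerator is a multiple of
b + 1. *)
Lemma inverse_formula_entry u v : n != 6%N ->
  (- (1 / 2) *: laplacian_mx F (@coal_adj b n)
    + (1 / (2 * (B + 1))) *: const_mx 1
    + (1 / (2 * (B + 1) * p)) *: R_mx F b n) (pos u) (pos v)
  = scaled_inv u v / (2 * p).
Proof.
move=> hn6.
have p_neq0 : p != 0 by rewrite subr_eq0 eqr_nat.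
have h_neq0 : B + 1 != 0 by rewrite natr1 pnatr_eq0.
have entryE (M : 'M[F]_(coal_order b n)) :
    (- (1 / 2) *: laplacian_mx F (@coal_adj b n)
      + (1 / (2 * (B + 1))) *: const_mx 1
      + (1 / (2 * (B + 1) * p)) *: M) (pos u) (pos v)
    = - (1 / 2) * (if u == v then (gdeg (@coal_adj b n) (pos u))%:R else - adj_coef u v)
      + 1 / (2 * (B + 1)) + 1 / (2 * (B + 1) * p) * M (pos u) (pos v).
  rewrite !mxE mulr1 (inj_eq (@pos_inj b n)) coal_adj_pos // -vadj_coef.
  by congr (_ * _ + _ + _); case: ifP => // _; case: vadj; rewrite ?oppr0.
rewrite entryE gdeg_coef /R_mx {entryE}.
case: u v => [[[i|j]|[k [i|j]]]|] [[[i'|j']|[k' [i'|j']]]|] //=.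
(* Locate the block that contains the entry before mxE can unfold the blocks;
   the inner splitting into base and other vertices needs a second pass. *)
all: rewrite ?block_mxEul ?block_mxEur ?block_mxEdl ?block_mxEdr.
all: rewrite ?block_mxEul ?block_mxEur ?block_mxEdl ?block_mxEdr.
all: rewrite ?mxblock_const ?mxrow_const ?mxcol_const.
all: rewrite ?(mxcol_const (fun=> r2 F n)) ?(mxrow_const (fun=> (r2 F n)^T)).
all: rewrite ?col_mxEu ?col_mxEd ?row_mxEl ?row_mxEr ?vtx_eqE ?andbF.
all: try case: (k == k') => /=.
all: rewrite ?[_^T _ _]mxE /R2 /R3 /R4 /r1 /r2 /r3.
all: rewrite ?[(_ *: block_mx _ _ _ _) _ _]mxE ?[(_ *: col_mx _ _) _ _]mxE.
all: rewrite ?block_mxEul ?block_mxEur ?block_mxEdl ?block_mxEdr ?col_mxEu ?col_mxEd.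
all: rewrite !mxE ?eqxx.
all: try case: (i == i') => /=.
all: try case: (j == j') => /=.
all: rewrite ?mulr1n; field.
all: by rewrite ?h_neq0 ?p_neq0.
Qed.
End Inverse.

Theorem theorem5p3 (F : realFieldType) (b n : nat)
    (hb : (1 <= b)%N) (hn : (3 <= n)%N) (hn6 : n <> 6%N) :
  let D := dist_mx F (@coal_adj b n) in
  let L := laplacian_mx F (@coal_adj b n) in
  D \in unitmx /\
  invmx D =
    - (1 / 2) *: L
    + (1 / (2 * (b%:R + 1))) *: const_mx 1
    + (1 / (2 * (b%:R + 1) * (n%:R - 6))) *: R_mx F b n.
Proof.
move=> D L; set M := (X in invmx D = X).
have p_neq0 : 2 * (n%:R - 6) != 0 :> F.
  by rewrite mulf_neq0 ?pnatr_eq0 // subr_eq0 eqr_nat; apply/eqP.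
have DM : D *m M = 1%:M.
  have [vof posK vofK] := pos_bij b n.
  apply/matrixP => x y; rewrite -(vofK x) -(vofK y) !mxE.
  rewrite (reindex _ (onW_bij _ (pos_bij b n))) (inj_eq (@pos_inj b n)) /=.
  rewrite (eq_bigr (fun w => (vdist (vof x) w)%:R * scaled_inv F w (vof y)
                             / (2 * (n%:R - 6)))); last first.
    by move=> w _; rewrite mxE gdist_pos // inverse_formula_entry ?mulrA //; apply/eqP.
  by rewrite -mulr_suml vdist_scaled_inv // mulrAC divff ?mul1r.
have [unitD _] := mulmx1_unit DM.
by split=> //; rewrite -[invmx D]mulmx1 -DM mulKmx.
Qed.
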